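(* Let $K$ be a non-Archimedean local field, let $d\ge 1$, and let $\mu$ be a Borel probability measure on $K^d$ with compact support. Let $\{\lambda_n\}\subset\widehat{K}^d\simeq K^d$ be a Bessel sequence of $L^2(\mu)$ and let $\{\gamma_n\}\subset\widehat{K}^d$ be another sequence. Suppose there exists a constant $C>0$ such that $$\forall n,\qquad |\gamma_n-\lambda_n|\le C.$$ Then $\{\gamma_n\}$ is also a Bessel sequence of $L^2(\mu)$.
   Context: $K$ is a non-discrete, locally compact, disconnected (i.e. non-Archimedean local) field with absolute value $|\cdot|$, ring of integers $\mathfrak{D}=\{x\in K:|x|\le 1\}$, and $\mathfrak{p}$ a prime element (a generator of the maximal ideal $\{|x|<1\}$). $K^d$ carries the norm $|x|=\max_j|x_j|$. Fix a character $\chi$ of $(K,+)$ which is equal to $1$ on $\mathfrak{D}$ and is non-constant on $\mathfrak{p}^{-1}\mathfrak{D}$. For $x,y\in K^d$ put $x\cdot y=\sum_{j} x_jy_j$ and $\chi_y(x)=\chi(y\cdot x)$; the map $y\mapsto\chi_y$ identifies $K^d$ with its dual group $\widehat{K}^d$. Write $\langle f,g\rangle_\mu=\int f\overline{g}\,d\mu$. A sequence $\{\lambda_n\}$ in $\widehat{K}^d$ is a Bessel sequence of $L^2(\mu)$ if there is a constant $B>0$ such that $\sum_n|\langle f,\chi_{\lambda_n}\rangle_\mu|^2\le B\|f\|^2_{L^2(\mu)}$ for all $f\in L^2(\mu)$. *)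

(* Defs.v *)
From HB Require Import structures.
From mathcomp Require Import all_boot all_order all_algebra.
From mathcomp Require Import all_classical all_reals all_analysis.
From mathcomp Require Import complex.

Set Implicit Arguments.
Unset Strict Implicit.
Unset Printing Implicit Defensive.

Import Order.TTheory GRing.Theory Num.Theory.
Import numFieldNormedType.Exports.
Import Normc.

Local Open Scope classical_set_scope.
Local Open Scope ring_scope.
Local Open Scope complex_scope.

(* The absolute value is not assumed to be normalized.  By [nbhs_absv] it
   defines the topology of K, which makes K a Hausdorff topological field. The
   ultrametric inequality already makes K disconnected; [disconnected_field]
   is redundant and only kept to match the usual definition. *)
HB.mixin Record isNonArchLocalField (R : realType) K
    & GRing.Field K & Topological K := {
  absv : K -> R ;
  absv_ge0 : forall x, 0 <= absv x ;
  absv_eq0 : forall x, absv x = 0 <-> x = 0 ;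
  absvM : forall x y, absv (x * y) = absv x * absv y ;
  absv_ultra : forall x y, absv (x + y) <= Num.max (absv x) (absv y) ;
  nbhs_absv : forall (x : K) (A : set K),
    nbhs x A <-> exists2 e : R, 0 < e & [set y | absv (y - x) < e] `<=` A ;
  nondiscrete_field : ~ open [set 0 : K] ;
  locally_compact_field : locally_compact [set: K] ;
  disconnected_field : ~ connected [set: K]
}.

#[short(type="nonArchLocalFieldType")]
HB.structure Definition NonArchLocalField (R : realType) :=
  {K of GRing.Field K & Topological K & isNonArchLocalField R K}.

(* Measurable spaces are pointed types in the library. *)
#[non_forgetful_inheritance]
HB.instance Definition _ (R : realType) (K : nonArchLocalFieldType R) :=
  isPointed.Build K 0.

Section local_field.
Variables (R : realType) (K : nonArchLocalFieldType R).

Definition integer_ring : set K := [set x | absv x <= 1].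

Definition prime_element (p : K) :=
  [set x : K | absv x < 1] = [set p * y | y in integer_ring].

(* [R[i]^o] is R[i] with the topology of its norm. *)
Definition character (chi : K -> R[i]) :=
  [/\ forall x y, chi (x + y) = chi x * chi y,
      forall x, normc (chi x) = 1 &
      continuous (chi : K -> R[i]^o)].

Definition nonconstant_on (A : set K) (f : K -> R[i]) :=
  exists x y, [/\ A x, A y & f x <> f y].

Definition vec_norm d (x : 'rV[K]_d) : R := \big[Num.max/0]_(j < d) absv (x 0 j).

Definition dotv d (x y : 'rV[K]_d) : K := \sum_(j < d) x 0 j * y 0 j.

Definition char_of (chi : K -> R[i]) d (y : 'rV[K]_d) : 'rV[K]_d -> R[i] :=
  fun x => chi (dotv y x).

End local_field.

Notation borel T := (g_sigma_algebraType (@open T)).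

Definition measure_support (R : realType) (T : ptopologicalType)
    (mu : {measure set (borel T) -> \bar R}) : set T :=
  [set x | forall U : set T, open U -> U x -> (0 < mu U)%E].

(* Integration and L^2 for complex-valued functions, which the library only
   provides for real-valued ones. *)
Section complex_L2.
Context {d} {T : measurableType d} {R : realType}.
Variable mu : {measure set T -> \bar R}.

Definition cintegral (f : T -> R[i]) : R[i] :=
  (\int[mu]_x complex.Re (f x)) +i* (\int[mu]_x complex.Im (f x)).

Definition L2_inner (f g : T -> R[i]) : R[i] :=
  cintegral (fun x => f x * (g x)^*).

Definition L2_sqnorm (f : T -> R[i]) : \bar R :=
  (\int[mu]_x ((normc (f x)) ^+ 2)%:E)%E.

(* Functions rather than almost-everywhere classes. *)
Definition L2 : set (T -> R[i]) :=
  [set f | [/\ measurable_fun [set: T] (fun x => complex.Re (f x)),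
               measurable_fun [set: T] (fun x => complex.Im (f x)) &
               (L2_sqnorm f < +oo)%E]].

End complex_L2.

Definition bessel_sequence (R : realType) (K : nonArchLocalFieldType R)
    (chi : K -> R[i]) (d : nat)
    (mu : {measure set (borel 'rV[K]_d) -> \bar R}) (lambda : nat -> 'rV[K]_d) :=
  exists2 B : R, 0 < B & forall f : 'rV[K]_d -> R[i], L2 mu f ->
    (\sum_(0 <= n <oo)
        ((normc (L2_inner mu f (char_of chi (lambda n)))) ^+ 2)%:E
      <= B%:E * L2_sqnorm mu f)%E.

(* Main.v *)
Require Import Defs.
From HB Require Import structures.
From mathcomp Require Import all_boot all_order all_algebra.
From mathcomp Require Import all_classical all_reals all_analysis.
From mathcomp Require Import complex measurable_realfun.

Import Order.TTheory GRing.Theory Num.Theory.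
Import numFieldNormedType.Exports.

Local Open Scope classical_set_scope.
Local Open Scope ring_scope.

(** The measure lives on a ball, on which a character does not notice a small
    change of its frequency.  If mu is carried by the ball of radius rho and
    |c| rho <= 1, then |c . x| <= 1 for mu-almost every x, so chi_c = 1 almost
    everywhere, because chi is trivial on the ring of integers.  Bounded sets of
    K^d are totally bounded, so finitely many vectors c approximate every
    gamma_n - lambda_n to within 1 / rho.  When c approximates
    gamma_n - lambda_n, one has chi_(gamma_n) = chi_(lambda_n) chi_c almost
    everywhere and
      <f, chi_(gamma_n)> = <f (chi_c)^*, chi_(lambda_n)>
    ([L2_inner_char_shift]).  Multiplication by the unimodular function
    (chi_c)^* preserves the L^2 norm.  Bounding each term by the sum over all
    the vectors c of the finite net and using the Bessel bound B of lambda once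
    for each of them gives a Bessel bound for gamma of B times the size of the
    net ([bessel_sequence_bounded_shift]).

    What remains is to find the net and the ball.  Balls are totally bounded
    ([ball_totally_bounded], [vec_ball_totally_bounded]) by local compactness of
    K and rescaling by small scalars, which exist because K is not discrete.
    The support of mu, being compact, is bounded ([compact_vec_bounded]), and its
    complement is null ([negligible_setC_support]); the latter requires K^d to
    be second countable ([vec_second_countable]), which follows from total
    boundedness. *)

(** * The absolute value of K *)

Section absolute_value.
Context {R : realType} {K : nonArchLocalFieldType R}.
Implicit Types x y : K.

Lemma absv0 : absv (0 : K) = 0.
Proof. exact/absv_eq0. Qed.

Lemma absv_gt0 x : (0 < absv x) = (x != 0).
Proof.
rewrite lt_def absv_ge0 andbT; congr (~~ _).
by apply/eqP/eqP => [/absv_eq0//|->]; rewrite absv0.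
Qed.

Lemma absv1 : absv (1 : K) = 1.
Proof.
have n0 : absv (1 : K) != 0 by rewrite gt_eqF// absv_gt0 oner_neq0.
by apply: (mulfI n0); rewrite -absvM !mulr1.
Qed.

Lemma absvN x : absv (- x) = absv x.
Proof.
have : absv (-1 : K) ^+ 2 = 1 by rewrite expr2 -absvM mulrNN mulr1 absv1.
move=> /eqP; rewrite sqrp_eq1 ?absv_ge0// => /eqP N1.
by rewrite -mulN1r absvM N1 mul1r.
Qed.

Lemma absvX x n : absv (x ^+ n) = absv x ^+ n.
Proof. by elim: n => [|n IHn]; rewrite ?expr0 ?absv1// !exprS absvM IHn. Qed.

Lemma absvV x : absv x^-1 = (absv x)^-1.
Proof.
have [->|x0] := eqVneq x 0; first by rewrite invr0 absv0 invr0.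
have n0 : absv x != 0 by rewrite gt_eqF// absv_gt0.
by apply: (mulfI n0); rewrite -absvM !divff// absv1.
Qed.

Lemma absv_sum_le (I : Type) (r : seq I) (F : I -> K) (c : R) :
  0 <= c -> (forall i, absv (F i) <= c) -> absv (\sum_(i <- r) F i) <= c.
Proof.
move=> c0 Fc; elim/big_ind: _ => // [|x y xc yc]; first by rewrite absv0.
by rewrite (le_trans (absv_ultra _ _))// ge_max xc yc.
Qed.

(** If every nonzero scalar had absolute value at least 1, the unit ball would
    be {0} and K would be discrete; powers of a nonzero scalar of absolute value
    below 1 are then as small as desired. *)
Lemma exists_small_scalar e : 0 < e -> exists2 t : K, t != 0 & absv t < e.
Proof.
move=> e0.
have [t /andP[t0 t1]] : exists t : K, (t != 0) && (absv t < 1).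
  apply: contrapT => nt; apply: (@nondiscrete_field R K).
  rewrite openE => _ /= ->; apply/nbhs_absv; exists 1 => // y /=.
  rewrite subr0 => y1; apply: contrapT => /eqP y0; apply: nt; exists y.
  by rewrite y0.
have at1 : `|absv t| < 1 by rewrite ger0_norm ?absv_ge0.
have /cvgrPdist_lt/(_ e e0)[n _ /(_ n (leqnn n))] := cvg_expr at1.
rewrite sub0r normrN ger0_norm ?exprn_ge0 ?absv_ge0// -absvX => tn.
by exists (t ^+ n) => //; rewrite expf_neq0.
Qed.

Lemma open_absv_ball y e : open [set x : K | absv (x - y) < e].
Proof.
rewrite openE => x /= xy; apply/nbhs_absv; exists e.
  exact: le_lt_trans (absv_ge0 _) xy.
move=> z /= zx; have -> : z - y = (z - x) + (x - y) by rewrite addrA subrK.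
by rewrite (le_lt_trans (absv_ultra _ _))// gt_max zx.
Qed.

(** A compact neighbourhood of 0 contains a small ball, which therefore has
    finite nets; a nonzero scalar t maps the given ball into the small one. *)
Lemma ball_totally_bounded r e : 0 < e ->
  exists s : seq K, forall x, absv x <= r ->
    exists2 y, y \in s & absv (x - y) < e.
Proof.
move=> e0.
have [V nV cV] : exists2 V, nbhs (0 : K) V & compact V.
  have [V nV [cV _]] := @locally_compact_field R K 0 I.
  by exists V => //; apply: filterS (nV : nbhs _ _) => x; exact.
move: nV => /nbhs_absv[e' e'0 subV].
(* |r| + 1 rather than r, as r may be zero or negative. *)
have [t t0 te] : exists2 t : K, t != 0 & absv t < e' / (`|r| + 1).
  by apply: exists_small_scalar; rewrite divr_gt0// ltr_wpDl.
(* The net has mesh e |t| so that division by t gives mesh e. *)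
move: cV; rewrite compact_cover => /(_ K [set: K]
  (fun y => [set x | absv (x - y) < e * absv t])).
case=> [i _|x _|s _ Vs]; first exact: open_absv_ball.
  by exists x => //=; rewrite subrr absv0 mulr_gt0// absv_gt0.
exists [seq t^-1 * y | y <- finmap.enum_fset s] => x xr.
have tx : absv (t * x - 0) < e'.
  rewrite subr0 absvM; apply: (@le_lt_trans _ _ (absv t * (`|r| + 1))).
    rewrite ler_wpM2l ?absv_ge0// (le_trans xr)// (le_trans (ler_norm r))//.
    by rewrite lerDl.
  by rewrite -ltr_pdivlMr// ltr_wpDl.
have [y ys /= xy] := Vs _ (subV _ tx).
exists (t^-1 * y); first exact: map_f.
have -> : x - t^-1 * y = t^-1 * (t * x - y) by rewrite mulrBr mulKf.
by rewrite absvM absvV mulrC ltr_pdivrMr// absv_gt0.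
Qed.

End absolute_value.

(** * Norm and topology of K^d *)

Section vectors.
Context {R : realType} {K : nonArchLocalFieldType R} {d : nat}.
Implicit Types x y c : 'rV[K]_d.

Lemma vec_norm_ge0 x : 0 <= vec_norm x.
Proof. exact: bigmax_ge_id. Qed.

Lemma vec_norm_leP x r :
  0 <= r -> reflect (forall j, absv (x 0 j) <= r) (vec_norm x <= r).
Proof.
move=> r0; apply: (iffP (bigmax_leP _ _ _ _)) => [[_ xr] j|xr]; first exact: xr.
by split.
Qed.

Lemma vec_norm_ltP x r :
  0 < r -> reflect (forall j, absv (x 0 j) < r) (vec_norm x < r).
Proof.
move=> r0; apply: (iffP (bigmax_ltP _ _ _ _)) => [[_ xr] j|xr]; first exact: xr.
by split.
Qed.

Lemma absv_le_vec_norm x j : absv (x 0 j) <= vec_norm x.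
Proof. by apply/(vec_norm_leP x); rewrite ?vec_norm_ge0. Qed.

Lemma vec_norm_ultra x y : vec_norm (x + y) <= Num.max (vec_norm x) (vec_norm y).
Proof.
apply/vec_norm_leP => [|j]; first by rewrite le_max vec_norm_ge0.
rewrite mxE (le_trans (absv_ultra _ _))// ge_max !le_max !absv_le_vec_norm.
by rewrite orbT.
Qed.

Lemma vec_norm_distC x y : vec_norm (x - y) = vec_norm (y - x).
Proof. by apply: eq_bigr => j _; rewrite !mxE -absvN opprB. Qed.

Lemma dotvDl x y c : dotv (x + y) c = dotv x c + dotv y c.
Proof. by rewrite -big_split/=; apply: eq_bigr => j _; rewrite mxE mulrDl. Qed.

Lemma dotvDr x y c : dotv c (x + y) = dotv c x + dotv c y.
Proof. by rewrite -big_split/=; apply: eq_bigr => j _; rewrite mxE mulrDr. Qed.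

Lemma absv_dotv_le x y : absv (dotv x y) <= vec_norm x * vec_norm y.
Proof.
apply: absv_sum_le => [|j]; first by rewrite mulr_ge0 ?vec_norm_ge0.
by rewrite absvM ler_pM ?absv_ge0 ?absv_le_vec_norm.
Qed.

(** [matrix] carries the product topology; this relates it to the max norm. *)
Lemma nbhs_vec_norm x (A : set 'rV[K]_d) :
  nbhs x A <-> exists2 e : R, 0 < e & [set y | vec_norm (y - x) < e] `<=` A.
Proof.
split=> [[P nP PA]|[e e0 eA]].
  have /choice[e eP] j : exists e : R,
      0 < e /\ [set y : K | absv (y - x 0 j) < e] `<=` P 0 j.
    by have /nbhs_absv[e e0 eP] := nP 0 j; exists e.
  exists (\big[Num.min/1]_j e j).
    by apply/bigmin_gtP; split=> // j _; have [] := eP j.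
  move=> y /= xy; apply: PA => i j; rewrite ord1.
  have [_] := eP j; apply => /=.
  apply: le_lt_trans (lt_le_trans xy (bigmin_le _ j e)).
  by have := absv_le_vec_norm (y - x) j; rewrite !mxE.
exists (fun i j => [set y : K | absv (y - x i j) < e]) => [i j|y /= xy].
  by apply/nbhs_absv; exists e.
by apply: eA; apply/vec_norm_ltP => // j; rewrite !mxE.
Qed.

Lemma open_vec_ball y e : open [set x | vec_norm (x - y) < e].
Proof.
rewrite openE => x /= xy; apply/nbhs_vec_norm; exists e.
  exact: le_lt_trans (vec_norm_ge0 _) xy.
move=> z /= zx; have -> : z - y = (z - x) + (x - y) by rewrite addrA subrK.
by rewrite (le_lt_trans (vec_norm_ultra _ _))// gt_max zx.
Qed.

(** The product of nets of the coordinates is a net for the max norm. *)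
Lemma vec_ball_totally_bounded r e : 0 < e ->
  exists s : seq 'rV[K]_d, forall x, vec_norm x <= r ->
    exists2 y, y \in s & vec_norm (x - y) < e.
Proof.
move=> e0; have [s sP] := @ball_totally_bounded R K r e e0.
exists (codom (fun f : {ffun 'I_d -> 'I_(size s)} => \row_j nth 0 s (f j))).
(* Each coordinate of x has a close point in s, recorded by its index. *)
move=> x xr.
have /choice[f fP] j : exists k : 'I_(size s), absv (x 0 j - nth 0 s k) < e.
  have [y ys xy] := sP _ (le_trans (absv_le_vec_norm x j) xr).
  have ys' : (index y s < size s)%N by rewrite index_mem.
  by exists (Ordinal ys'); rewrite nth_index.
exists (\row_j nth 0 s ([ffun j => f j] j)).
  exact: (codom_f (fun f : {ffun 'I_d -> 'I_(size s)} => \row_j nth 0 s (f j))).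
by apply/vec_norm_ltP => // j; rewrite !mxE ffunE.
Qed.

Lemma compact_vec_bounded (A : set 'rV[K]_d) :
  compact A -> exists2 r : R, 0 < r & A `<=` [set x | vec_norm x <= r].
Proof.
move=> /compact_near_coveringP/(_ R +oo (fun r x => vec_norm x <= r)) cA.
have [x _|r [_ rA]] := cA _; last first.
  by exists (Num.max (r + 1) 1); [rewrite lt_max ltr01 orbT
    |apply: rA; rewrite lt_max ltrDl ltr01].
near=> y r; have -> : (y : 'rV[K]_d) = (y - x) + x by rewrite subrK.
rewrite (le_trans (vec_norm_ultra _ _))// ge_max.
have xr : Num.max 1 (vec_norm x) < r by near: r; apply: nbhs_pinfty_gt; exact: num_real.
have yx : vec_norm ((y : 'rV[K]_d) - x) < 1.
  by near: y; apply/nbhs_vec_norm; exists 1.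
by move: xr; rewrite gt_max => /andP[r1 xr]; rewrite !ltW// (lt_trans yx).
Unshelve. all: by end_near. Qed.

(** The base consists of the balls of radius 1 / (m + 1) around the points of a
    finite net of the ball of radius m, for all m: once m is large, any given
    point x lies in the ball of radius m, and any given neighbourhood of x
    contains the ball of radius 1 / (m + 1) around the net point next to x. *)
Lemma vec_second_countable : @second_countable 'rV[K]_d.
Proof.
have /choice[s sP] (m : nat) : exists s : seq 'rV[K]_d,
    forall x, vec_norm x <= m%:R ->
      exists2 y, y \in s & vec_norm (x - y) < m.+1%:R^-1.
  by apply: vec_ball_totally_bounded; rewrite invr_gt0.
exists (\bigcup_m [set [set x | vec_norm (x - y) < m.+1%:R^-1] | y in [set` s m]]).
  apply: bigcup_countable => // m _; apply: finite_set_countable.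
  exact/finite_image/finite_seq.
split=> [_ [m _ [y _ <-]]|x A /nbhs_vec_norm[e e0 eA]].
  exact: open_vec_ball.
(* m has to exceed both |x|, for the net to reach x, and 1 / e. *)
pose m := maxn (Num.bound (vec_norm x)) (Num.bound e^-1).
have xm : vec_norm x <= m%:R.
  rewrite ltW// (lt_le_trans (archi_boundP (vec_norm_ge0 x)))// ler_nat.
  exact: leq_maxl.
have me : m.+1%:R^-1 <= e.
  rewrite invf_ple ?posrE// ltW// (lt_le_trans (archi_boundP _))//.
    by rewrite invr_ge0 ltW.
  by rewrite ler_nat leqW// leq_maxr.
have [y ys xy] := sP m x xm.
exists [set z | vec_norm (z - y) < m.+1%:R^-1].
  by split => //; exists m => //; exists y.
move=> z /= zy; apply: eA => /=; rewrite (lt_le_trans _ me)//.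
have -> : z - x = (z - y) + (y - x) by rewrite addrA subrK.
rewrite (le_lt_trans (vec_norm_ultra _ _))// gt_max zy/=.
by rewrite vec_norm_distC.
Qed.

End vectors.

(** * Borel measures and their support *)

Section borel_measures.
Context {R : realType} {T : ptopologicalType}.

Lemma open_borel_measurable (U : set T) :
  open U -> measurable (U : set (borel T)).
Proof. by move=> oU; exact: sub_gen_smallest. Qed.

Lemma continuous_borel_measurable (f : T -> R) :
  continuous f -> measurable_fun [set: borel T] (f : borel T -> R).
Proof.
move=> /continuousP cf; apply: (measurability _ (RGenOpens.measurableE R)).
move=> _ [_ [a [b ->] <-]]; rewrite setTI.
by apply: open_borel_measurable; apply: cf; exact: interval_open.
Qed.

(** A point outside the support has a null open neighbourhood, hence a null
    member of the countable base around it; countably many null sets thus cover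
    the complement. *)
Lemma negligible_setC_support (mu : {measure set (borel T) -> \bar R}) :
  @second_countable T -> mu.-negligible (~` measure_support mu).
Proof.
move=> [B cB [oB bB]].
pose N := B `&` [set U | mu U = 0%E].
have cN : countable N by apply: sub_countable cB; apply: subset_card_le => U [].
have sN : ~` measure_support mu `<=` \bigcup_(U in N) U.
  move=> x /=; apply: contra_notP => xN U oU Ux.
  rewrite lt0e measure_ge0 andbT; apply/eqP => U0.
  apply: xN; have [V [BV Vx] VU] := bB x U (open_nbhs_nbhs (conj oU Ux)).
  exists V => //; split => //=; apply/eqP.
  rewrite -measure_le0 -U0; apply: le_measure => //; rewrite inE.
    exact: open_borel_measurable (oB _ BV).
  exact: open_borel_measurable.
apply: (@negligibleS _ (borel T) R mu _ _ sN).
have /pfcard_geP[->|[F]] := cN.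
  by rewrite bigcup_set0; exact: negligible_set0.
have -> : \bigcup_(U in N) U = \bigcup_k F k.
  apply/seteqP; split=> [x [U NU Ux]|x [k _ Fx]].
    by have [k _ FkU] := @surj _ _ _ _ F _ NU; exists k => //; rewrite FkU.
  by exists (F k) => //; exact: funS.
apply: (@negligible_bigcup _ (borel T)) => k; have [BFk Fk0] : N (F k) by exact: funS.
by apply/negligibleP => //; exact: open_borel_measurable (oB _ BFk).
Qed.

End borel_measures.

(** * Square-integrable complex functions *)

Section complex_L2_lemmas.
Context {d} {T : measurableType d} {R : realType}.
Context (mu : {measure set T -> \bar R}).
Implicit Types f g u : T -> R[i].

Definition cmeasurable f :=
  measurable_fun [set: T] (fun x => complex.Re (f x)) /\
  measurable_fun [set: T] (fun x => complex.Im (f x)).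

Lemma cmeasurableM f g : cmeasurable f -> cmeasurable g ->
  cmeasurable (fun x => f x * g x).
Proof.
move=> [mRf mIf] [mRg mIg]; split.
  rewrite (_ : (fun x => _) =
      (fun x => complex.Re (f x) * complex.Re (g x)) \-
      (fun x => complex.Im (f x) * complex.Im (g x))).
    by apply: measurable_funB; exact: measurable_funM.
  by apply/funext => x /=; case: (f x) (g x) => [a b] [a' b'].
rewrite (_ : (fun x => _) =
    (fun x => complex.Re (f x) * complex.Im (g x)) \+
    (fun x => complex.Im (f x) * complex.Re (g x))).
  by apply: measurable_funD; exact: measurable_funM.
by apply/funext => x /=; case: (f x) (g x) => [a b] [a' b'].
Qed.

Lemma cmeasurable_conj f : cmeasurable f -> cmeasurable (fun x => ((f x)^*)%C).
Proof.
move=> [mRf mIf]; split.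
  by rewrite (_ : (fun x => _) = (fun x => complex.Re (f x)))//;
    apply/funext => x; case: (f x).
rewrite (_ : (fun x => _) = \- (fun x => complex.Im (f x))).
  exact: measurableT_comp.
by apply/funext => x /=; case: (f x).
Qed.

Lemma ae_eq_cintegral (P : T -> Prop) f g : cmeasurable f -> cmeasurable g ->
  {ae mu, forall x, P x} -> (forall x, P x -> f x = g x) ->
  cintegral mu f = cintegral mu g.
Proof.
move=> [mRf mIf] [mRg mIg] aeP fg; congr (_ +i* _)%C; congr fine;
  apply: ae_eq_integral => //; try exact/measurable_EFinP;
  by apply: filterS aeP => x /= /fg -> _.
Qed.

Lemma L2_sqnorm_mul_unimodular f u : (forall x, Normc.normc (u x) = 1) ->
  L2_sqnorm mu (fun x => f x * u x) = L2_sqnorm mu f.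
Proof.
by move=> u1; apply: eq_integral => x _; rewrite Normc.normcM u1 mulr1.
Qed.

Lemma L2_mul_unimodular f u : cmeasurable u ->
  (forall x, Normc.normc (u x) = 1) ->
  L2 mu f -> L2 mu (fun x => f x * u x).
Proof.
move=> mu_ u1 [mRf mIf foo]; have [mR mI] := cmeasurableM _ _ (conj mRf mIf) mu_.
by split => //; rewrite L2_sqnorm_mul_unimodular.
Qed.

End complex_L2_lemmas.

(** * Characters and Bessel sequences *)

Lemma normc_conj (R : realType) (z : R[i]) : Normc.normc (z^*)%C = Normc.normc z.
Proof. by case: z => a b /=; rewrite sqrrN. Qed.

Section characters.
Context {R : realType} {K : nonArchLocalFieldType R} {d : nat}.
Context (chi : K -> R[i]) (chiP : character chi)
  (chi1 : forall x, integer_ring x -> chi x = 1).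
Implicit Types (c x : 'rV[K]_d) (mu : {measure set (borel 'rV[K]_d) -> \bar R}).

Lemma char_ofD a c x : char_of chi (a + c) x = char_of chi a x * char_of chi c x.
Proof. by have [chiD _ _] := chiP; rewrite /char_of dotvDl chiD. Qed.

Lemma normc_char_of c x : Normc.normc (char_of chi c x) = 1.
Proof. by have [_ chiN _] := chiP; exact: chiN. Qed.

Lemma char_of_eq1 c x : vec_norm c * vec_norm x <= 1 -> char_of chi c x = 1.
Proof. by move=> cx; apply: chi1; exact: le_trans (absv_dotv_le _ _) cx. Qed.

(** A displacement h with |h| <= 1 / (|c| + 1) has |c . h| <= 1, where chi is
    trivial. *)
Lemma char_of_locally_constant c x :
  \forall y \near x, char_of chi c y = char_of chi c x.
Proof.
have c0 : 0 < vec_norm c + 1 by rewrite ltr_wpDl ?vec_norm_ge0.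
apply/nbhs_vec_norm; exists (vec_norm c + 1)^-1; first by rewrite invr_gt0.
move=> y /= yx; have -> : y = (y - x) + x by rewrite subrK.
have [chiD _ _] := chiP; rewrite /char_of dotvDr chiD.
rewrite [chi (dotv c (y - x))]char_of_eq1 ?mul1r//.
rewrite (@le_trans _ _ ((vec_norm c + 1) * (vec_norm c + 1)^-1))//.
  by rewrite ler_pM ?vec_norm_ge0 ?lerDl// ltW.
by rewrite divff// gt_eqF.
Qed.

Lemma cmeasurable_char_of c : cmeasurable (char_of chi c : borel 'rV[K]_d -> R[i]).
Proof.
split; apply: continuous_borel_measurable => x.
  apply: (@near_cst_continuous _ _ (complex.Re (char_of chi c x))).
  by apply: filterS (char_of_locally_constant c x) => y ->.
apply: (@near_cst_continuous _ _ (complex.Im (char_of chi c x))).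
by apply: filterS (char_of_locally_constant c x) => y ->.
Qed.

(** On the ball of radius rho the character of frequency b - a - c is 1, so
    chi_b = chi_c chi_a almost everywhere. *)
Lemma L2_inner_char_shift mu (f : 'rV[K]_d -> R[i]) rho a b c :
  {ae mu, forall x, vec_norm x <= rho} -> cmeasurable (f : borel _ -> R[i]) ->
  vec_norm (b - a - c) * rho <= 1 ->
  L2_inner mu f (char_of chi b) =
  L2_inner mu (fun x => f x * ((char_of chi c x)^*)%C) (char_of chi a).
Proof.
move=> mu_rho mf bac; apply: (ae_eq_cintegral mu _ _ _ _ _ mu_rho) => [||x xrho].
- apply: cmeasurableM => //; apply: cmeasurable_conj.
  exact: cmeasurable_char_of.
- apply: cmeasurableM; last exact/cmeasurable_conj/cmeasurable_char_of.
  by apply: cmeasurableM => //; exact/cmeasurable_conj/cmeasurable_char_of.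
have -> : b = (b - a - c) + (c + a).
  by rewrite addrA subrK subrK.
rewrite char_ofD char_of_eq1 ?mul1r.
  by rewrite char_ofD rmorphM/= mulrA.
by apply: le_trans bac; rewrite ler_wpM2l ?vec_norm_ge0.
Qed.

Lemma ae_vec_norm_le mu : compact (measure_support mu) ->
  exists2 rho : R, 0 < rho & {ae mu, forall x, vec_norm x <= rho}.
Proof.
move=> /compact_vec_bounded[rho rho0 Srho]; exists rho => //.
have := negligible_setC_support mu vec_second_countable.
by apply: (@negligibleS _ (borel 'rV[K]_d)) => x; apply: contra_not; exact: Srho.
Qed.

(** The net s approximates all gamma_n - lambda_n with mesh 1 / rho.  Each
    coefficient of f along gamma is then one of the coefficients of the twisted
    functions [tw c], c in s, along lambda. *)
Lemma bessel_sequence_bounded_shift mu (lambda gamma : nat -> 'rV[K]_d) C :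
  compact (measure_support mu) -> bessel_sequence chi mu lambda ->
  (forall n, vec_norm (gamma n - lambda n) <= C) ->
  bessel_sequence chi mu gamma.
Proof.
move=> /ae_vec_norm_le[rho rho0 mu_rho] [B B0 lambdaB] gammaC.
have rV0 : 0 < rho^-1 by rewrite invr_gt0.
have [s sP] := @vec_ball_totally_bounded R K d C _ rV0.
(* The successor keeps the bound positive even for an empty net. *)
exists (B * (size s).+1%:R); first by rewrite mulr_gt0.
move=> f L2f; have [mRf mIf foo] := L2f.
pose tw c x := f x * ((char_of chi c x)^*)%C.
have tw1 c x : Normc.normc ((char_of chi c x)^*)%C = 1.
  by rewrite normc_conj normc_char_of.
have L2tw c : L2 mu (tw c).
  apply: L2_mul_unimodular => //.
  exact/cmeasurable_conj/cmeasurable_char_of.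
pose term c n := ((Normc.normc (L2_inner mu (tw c) (char_of chi (lambda n)))) ^+ 2)%:E.
have term0 c n : (0 <= term c n)%E by rewrite lee_fin sqr_ge0.
apply: (@le_trans _ _ (\sum_(0 <= n <oo) \sum_(c <- s) term c n)%E).
  apply: lee_nneseries => [n _ _|n _]; first by rewrite lee_fin sqr_ge0.
  have [c cs cn] := sP _ (gammaC n).
  (* The term of c in the finite sum is the one on the left; others are >= 0. *)
  rewrite (big_rem c)//= /term -(@L2_inner_char_shift mu f rho _ (gamma n)) //.
    by rewrite leeDl// sume_ge0// => ? _; exact: term0.
  by rewrite -ler_pdivlMr// mul1r ltW.
rewrite nneseries_sum//.
have f0 : (0 <= L2_sqnorm mu f)%E.
  by apply: integral_ge0 => x _; rewrite lee_fin sqr_ge0.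
apply: (@le_trans _ _ (\sum_(c <- s) (B%:E * L2_sqnorm mu f))%E).
  apply: lee_sum => c _; apply: le_trans (lambdaB _ (L2tw c)) _.
  by rewrite L2_sqnorm_mul_unimodular.
have /fineK <- : L2_sqnorm mu f \is a fin_num by rewrite ge0_fin_numE.
rewrite -!EFinM sumEFin lee_fin big_const_seq count_predT iter_addr_0.
rewrite mulrAC -[leLHS]mulr_natr ler_wpM2l ?ler_nat//.
by rewrite mulr_ge0 ?fine_ge0// ltW.
Qed.

End characters.

Theorem theorem1p2 (R : realType) (K : nonArchLocalFieldType R)
  (p : K) (hp : prime_element p)
  (chi : K -> R[i]) (hchi : character chi)
  (hchi1 : forall x, integer_ring x -> chi x = 1)
  (hchi2 : nonconstant_on [set p^-1 * y | y in @integer_ring R K] chi)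
  (d : nat) (hd : (0 < d)%N)
  (mu : probability (borel 'rV[K]_d) R)
  (hmu : compact (measure_support mu))
  (lambda : nat -> 'rV[K]_d) (hlambda : bessel_sequence chi mu lambda)
  (gamma : nat -> 'rV[K]_d)
  (hgamma : exists2 C : R, 0 < C & forall n, vec_norm (gamma n - lambda n) <= C) :
  bessel_sequence chi mu gamma.
Proof.
have [C _ gammaC] := hgamma.
exact: bessel_sequence_bounded_shift hchi hchi1 _ _ _ _ hmu hlambda gammaC.
Qed.
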